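(* For every odd positive integer $n$, $$P_{\frac{n+1}{2}}(x;n)=2^{n+1}\,\mathrm{Sylv}\left(\tfrac12;\tfrac{n-1}{2}\right)\mathrm{Sylv}\left(\tfrac x2;\tfrac{n-1}{2}\right).$$
   Context: Put $a(x)=2x(2x-1)$. $P_0(x;y)=1$, and for $k\ge1$, $P_k(x;y)$ is the determinant of the $k\times k$ tridiagonal matrix with diagonal entries $(y-4(i-1))x$ in position $(i,i)$ $(1\le i\le k)$, entries $a(i)$ in position $(i,i+1)$, and entries $-a\left(\frac{y-2i+2}{2}\right)$ in position $(i+1,i)$ $(1\le i\le k-1)$. For $m\in\mathbb{Z}_{\ge0}$, the Sylvester determinant $\mathrm{Sylv}(x;m)$ is the determinant of the $(m+1)\times(m+1)$ tridiagonal matrix with all diagonal entries equal to $x$, entry $i$ in position $(i,i+1)$, and entry $m-i+1$ in position $(i+1,i)$ $(1\le i\le m)$; in particular $\mathrm{Sylv}(x;0)=x$. *)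

(* Defs.v *)
From HB Require Import structures.
From mathcomp Require Import all_boot all_order all_algebra.
Set Implicit Arguments.
Unset Strict Implicit.
Unset Printing Implicit Defensive.
Import GRing.Theory.
Local Open Scope ring_scope.

(* Tridiagonal matrix with d, u, l the diagonal, upper and lower entries,
   numbered from 1: d i is in position (i, i), u i in position (i, i+1) and
   l i in position (i+1, i), whereas the ordinals are numbered from 0. *)
Definition tridiag (R : nzRingType) (k : nat) (d u l : nat -> R) : 'M[R]_k :=
  \matrix_(i < k, j < k)
    if j == i :> nat then d i.+1
    else if j == i.+1 :> nat then u i.+1
    else if i == j.+1 :> nat then l j.+1
    else 0.

Definition a (F : fieldType) (x : F) : F := 2 * x * (2 * x - 1).

(* For k = 0 this is the determinant of the empty matrix, which is 1. *)
Definition P (F : fieldType) (k : nat) (x y : F) : F :=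
  \det (tridiag k (fun i => (y - 4 * (i%:R - 1)) * x)
                  (fun i => a i%:R)
                  (fun i => - a ((y - 2 * i%:R + 2) / 2))).

Definition Sylv (F : fieldType) (x : F) (m : nat) : F :=
  \det (tridiag m.+1 (fun=> x)
                     (fun i => i%:R)
                     (fun i => m%:R - i%:R + 1)).

(* Main.v *)
Require Import Defs.
From mathcomp Require Import all_boot all_order all_algebra ring zify.
Set Implicit Arguments.
Unset Strict Implicit.
Import GRing.Theory.
Local Open Scope ring_scope.

(**
Both determinants come from the representation of sl2 on the binary forms of
degree N. Dehomogenized to polynomials p in X of size at most N.+1, it is given
by D p = p' and Y p = N X p - X^2 p'.

On coefficients, Sylvester's matrix with diagonal z is z + D + Y for N = m,
while the matrix of P_(m+1)(x; 2m+1) is D^2 - Y^2 + x (DY - YD) for N = 2m+1,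
restricted to the coefficients of even index. Now change variables to
u = 1 + X and v = 1 - X. The monomial u^a v^b with a + b = N is an eigenvector
of D + Y for a - b ([kraw_eigen]), and D - Y sends it to
a u^(a-1) v^(b+1) - b u^(a+1) v^(b-1) ([kraw_shift]).

- Sylvester's matrix becomes diagonal, so Sylv(z; m) is the product of the
  z - m + 2j over 0 <= j <= m ([Sylv_prod]).
- Since D^2 - Y^2 and DY - YD are quadratic expressions in D + Y and D - Y, the
  pencil sends u^a v^b to a combination of its two neighbours alone, with
  coefficients linear in x ([pencil_kraw]). On the basis formed by the even
  parts of u^(m+1+j) v^(m-j), 0 <= j <= m, it is tridiagonal, and its diagonal
  vanishes except in the corner j = 0, where the two monomials in the middle
  have the same even part ([P_corner_tridiag]).

The continuant of such a matrix skips every other step, hence it is a product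
([det_corner_tridiag]): with R(z) the product of the z - 2m + 4j over
0 <= j <= m, one gets P_(m+1)(x; 2m+1) = R(1) R(x). Doubling each factor of
Sylv(z/2; m) gives R(z), which is the theorem.
*)

(** * Products with a tridiagonal matrix *)

(** The condition at k stands for the missing entry to the right of the last
column. *)
Lemma sum_tridiag_row (R : nzRingType) (k : nat) (d u l : nat -> R) (f : nat -> R)
    (i : 'I_k) : u k * f k = 0 ->
  \sum_(j < k) tridiag k d u l i j * f j =
    d i.+1 * f i + u i.+1 * f i.+1 + (if i == 0%N :> nat then 0 else l i * f i.-1).
Proof.
move=> uk0; have lt_ik := ltn_ord i.
have entryE (j : 'I_k) : tridiag k d u l i j * f j =
    (if j == i :> nat then d i.+1 * f j else 0) +
    (if j == i.+1 :> nat then u i.+1 * f j else 0) +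
    (if (i != 0%N :> nat) && (j == i.-1 :> nat) then l i * f j else 0).
  rewrite mxE (eq_sym (i : nat) j.+1).
  have -> : (i != 0%N :> nat) && (j == i.-1 :> nat) = (j.+1 == i).
    by case: (i : nat).
  case: eqVneq => [->|ne_ji].
    by rewrite (ltn_eqF (ltnSn i)) (gtn_eqF (ltnSn i)) !addr0.
  case: eqVneq => [->|_].
    by rewrite (gtn_eqF (leqW (ltnSn i))) add0r addr0.
  by rewrite !add0r; case: eqP => [->|_] //; exact: mul0r.
rewrite (eq_bigr _ (fun j _ => entryE j)) !big_split /= -!big_mkcond /=.
rewrite (big_ord1_eq _ (fun j => d i.+1 * f j)) lt_ik.
rewrite (big_ord1_eq _ (fun j => u i.+1 * f j)).
congr (_ + _ + _).
  case: (ltnP i.+1 k) => [//|le_ki].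
  have -> : i.+1 = k by apply/eqP; rewrite eqn_leq lt_ik.
  by rewrite uk0.
case: eqVneq => /= [_|i_n0]; first by rewrite big_pred0.
by rewrite (big_ord1_eq _ (fun j => l i * f j)) (leq_ltn_trans (leq_pred _)).
Qed.

Lemma trmx_tridiag (R : nzRingType) (k : nat) (d u l : nat -> R) :
  (tridiag k d u l)^T = tridiag k d l u.
Proof.
apply/matrixP=> i j; rewrite !mxE (eq_sym (i : nat) (j : nat)).
case: eqVneq => [-> //|_]; case: eqVneq => [->|//].
by rewrite (ltn_eqF (leqW (ltnSn j))).
Qed.

Lemma sum_tridiag_col (R : comNzRingType) (k : nat) (d u l : nat -> R)
    (f : nat -> R) (j : 'I_k) : l k * f k = 0 ->
  \sum_(i < k) f i * tridiag k d u l i j =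
    d j.+1 * f j + l j.+1 * f j.+1 + (if j == 0%N :> nat then 0 else u j * f j.-1).
Proof.
move=> lk0; rewrite -sum_tridiag_row //; apply: eq_bigr => i _.
by rewrite mulrC -trmx_tridiag mxE.
Qed.

(** * Continuants *)

Lemma det_tridiag0 (R : comNzRingType) (d u l : nat -> R) :
  \det (tridiag 0 d u l) = 1.
Proof. exact: det_mx00. Qed.

Lemma det_tridiag1 (R : comNzRingType) (d u l : nat -> R) :
  \det (tridiag 1 d u l) = d 1.
Proof. by rewrite det_mx11 mxE. Qed.

Lemma det_tridiagSS (R : comNzRingType) (k : nat) (d u l : nat -> R) :
  \det (tridiag k.+2 d u l) =
    d k.+2 * \det (tridiag k.+1 d u l) - u k.+1 * l k.+1 * \det (tridiag k d u l).
Proof.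
(* Only the two last entries of the last row are nonzero. *)
rewrite (expand_det_row _ ord_max) !big_ord_recr /= big1 => [|j _]; last first.
  by have := ltn_ord j; rewrite mxE /=; do 3!(case: eqP; first lia) => *; rewrite mul0r.
rewrite add0r addrC; congr (_ + _).
  rewrite mxE /= eqxx /cofactor -signr_odd oddD addbb mul1r.
  by congr (_ * \det _); apply/matrixP=> i j; rewrite !mxE !lift_max.
rewrite mxE /= (ltn_eqF (ltnSn k)) (ltn_eqF (leqW (ltnSn k))) eqxx.
rewrite /cofactor -signr_odd oddD /= addNb addbb expr1 mulN1r mulrN.
rewrite [u _ * _]mulrC -mulrA; congr (- (_ * _)).
(* In that minor the last column has only its bottom entry. *)
rewrite (expand_det_col _ ord_max) big_ord_recr /= big1 => [|i _]; last first.
  have := ltn_ord i; rewrite !mxE /= /bump; do 3!(case: eqP; first lia) => *.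
  by rewrite mul0r.
rewrite add0r !mxE /= /bump.
rewrite leqnn ltnn add0n add1n (gtn_eqF (ltnSn k)) eqxx.
rewrite /cofactor -signr_odd oddD addbb mul1r; congr (_ * \det _).
have bumpK (i : 'I_k) (h : nat) : (k <= h)%N -> ((h <= i) + i)%N = i.
  by move=> le_kh; rewrite leqNgt (leq_trans (ltn_ord i) le_kh).
by apply/matrixP=> i j; rewrite !mxE /= /bump !(bumpK _ k) // !bumpK.
Qed.

(** * The change of variables in binary forms *)

(** The monomial u^a v^b in u = 1 + X and v = 1 - X. Its coefficients are
values of Krawtchouk polynomials. *)
Definition kraw (F : fieldType) (a b : nat) : {poly F} :=
  (1 + 'X) ^+ a * (1 - 'X) ^+ b.

(** The operator t d/ds on forms of degree N in s and t, written at s = 1 and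
t = X; the companion operator s d/dt is then the derivative. *)
Definition raise (F : fieldType) (N : nat) (p : {poly F}) : {poly F} :=
  'X * p *+ N - 'X^2 * p^`().

Lemma deriv_kraw (F : fieldType) (a b : nat) :
  (kraw F a b)^`() = kraw F a.-1 b *+ a - kraw F a b.-1 *+ b.
Proof.
rewrite /kraw derivM !deriv_exp derivD derivB -polyC1 derivC derivX.
rewrite polyC1; move: (_ ^+ a) (_ ^+ a.-1) (_ ^+ b) (_ ^+ b.-1) => A A' B B'; ring.
Qed.

Lemma raise_kraw (F : fieldType) (a b : nat) :
  raise (a + b) (kraw F a b) = 'X * (kraw F a.-1 b *+ a + kraw F a b.-1 *+ b).
Proof.
rewrite /raise deriv_kraw /kraw.
by case: a b => [|a] [|b] /=; rewrite ?exprS; move: (_ ^+ _) (_ ^+ _) => *; ring.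
Qed.

(** The derivation s d/dt + t d/ds fixes u = s + t and negates v = s - t. *)
Lemma kraw_eigen (F : fieldType) (a b : nat) :
  (kraw F a b)^`() + raise (a + b) (kraw F a b) =
    (a%:R - b%:R) * kraw F a b.
Proof.
rewrite raise_kraw deriv_kraw /kraw.
by case: a b => [|a] [|b] /=; rewrite ?exprS; move: (_ ^+ _) (_ ^+ _) => *; ring.
Qed.

(** The derivation s d/dt - t d/ds sends u to v and v to - u. When a = 0 or
b = 0 the truncated predecessor is harmless, its coefficient being 0. *)
Lemma kraw_shift (F : fieldType) (a b : nat) :
  (kraw F a b)^`() - raise (a + b) (kraw F a b) =
    a%:R * kraw F a.-1 b.+1 - b%:R * kraw F a.+1 b.-1.
Proof.
rewrite raise_kraw deriv_kraw /kraw.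
by case: a b => [|a] [|b] /=; rewrite ?exprS; move: (_ ^+ _) (_ ^+ _) => *; ring.
Qed.

(** For N odd, the matrix of this operator in the basis of the even powers of X
up to N is the one whose determinant is P_((N+1)/2)(x; N). *)
Definition pencil (F : fieldType) (N : nat) (x : F) (p : {poly F}) : {poly F} :=
  p^`()^`() - raise N (raise N p) +
    x%:P * ((raise N p)^`() - raise N p^`()).

Lemma raiseD (F : fieldType) (N : nat) (p q : {poly F}) :
  raise N (p + q) = raise N p + raise N q.
Proof. by rewrite /raise derivD; ring. Qed.

Lemma raiseB (F : fieldType) (N : nat) (p q : {poly F}) :
  raise N (p - q) = raise N p - raise N q.
Proof. by rewrite /raise derivB; ring. Qed.

Lemma raise_natM (F : fieldType) (N n : nat) (p : {poly F}) :
  raise N (n%:R * p) = n%:R * raise N p.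
Proof. by rewrite /raise mulr_natl derivMn; ring. Qed.

Lemma deriv_natM (F : fieldType) (n : nat) (p : {poly F}) :
  (n%:R * p)^`() = n%:R * p^`().
Proof. by rewrite !mulr_natl derivMn. Qed.

(** With al = D + Y and be = D - Y, twice the pencil is
al be + be al + x (be al - al be). Each product shifts u^a v^b once, by be, and
scales it, by al. *)
Lemma pencil_kraw (F : fieldType) (a b : nat) (x : F) : 2 != 0 :> F ->
  pencil (a + b) x (kraw F a b) =
    ((a%:R - b%:R - 1 + x) * a%:R) *: kraw F a.-1 b.+1 -
    ((a%:R - b%:R + 1 - x) * b%:R) *: kraw F a.+1 b.-1.
Proof.
move=> nz2; have nz2P : 2 != 0 :> {poly F} by rewrite -polyC_natr polyC_eq0.
set N := (a + b)%N; set g := kraw F a b.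
have eig := kraw_eigen F a b; have shf := kraw_shift F a b.
rewrite -/g -/N in eig shf.
pose al (p : {poly F}) := p^`() + raise N p.
pose be (p : {poly F}) := p^`() - raise N p.
have be_al : be (al g) = (a%:R - b%:R) * be g.
  rewrite /al eig /be mulrBl derivB raiseB !deriv_natM !raise_natM; ring.
have al_be : al (be g) = (a%:R - b%:R - 2) * (a%:R * kraw F a.-1 b.+1) -
    (a%:R - b%:R + 2) * (b%:R * kraw F a.+1 b.-1).
  rewrite /be shf /al derivB raiseB !deriv_natM !raise_natM.
  have up : a%:R * ((kraw F a.-1 b.+1)^`() + raise N (kraw F a.-1 b.+1)) =
      (a%:R - b%:R - 2) * (a%:R * kraw F a.-1 b.+1).
    rewrite /N; case: (a) => [|a']; first by ring.
    by rewrite addSnnS kraw_eigen /=; ring.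
  have dn : b%:R * ((kraw F a.+1 b.-1)^`() + raise N (kraw F a.+1 b.-1)) =
      (a%:R - b%:R + 2) * (b%:R * kraw F a.+1 b.-1).
    rewrite /N; case: (b) => [|b']; first by ring.
    by rewrite -addSnnS kraw_eigen /=; ring.
  by rewrite -up -dn; ring.
(* The characteristic is not 2, so it suffices to compare the doubles. *)
apply: (mulfI nz2P).
transitivity (al (be g) + be (al g) + x%:P * (be (al g) - al (be g))).
  by rewrite /pencil /al /be (derivB g^`()) (derivD g^`()) raiseB raiseD; ring.
rewrite al_be be_al /be shf -!mul_polyC !(polyCM, polyCB, polyCD, polyC_natr) polyC1.
by ring.
Qed.

Lemma coef_raise (F : fieldType) (N i : nat) (p : {poly F}) :
  (raise N p)`_i = if i == 0%N then 0 else (N%:R - i.-1%:R) * p`_i.-1.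
Proof.
rewrite /raise coefB coefMn coefXM coefXnM coef_deriv.
case: i => [|[|i]] /=; rewrite ?mul0rn ?subrr //; first by ring.
by rewrite subSS subn1 /=; ring.
Qed.

Lemma size_kraw (F : fieldType) (a b : nat) : (size (kraw F a b) <= (a + b).+1)%N.
Proof.
have size_exp_leq (p : {poly F}) n : (size p <= 2)%N -> (size (p ^+ n) <= n.+1)%N.
  move=> le2; rewrite (leq_trans (leqSpred _)) // size_exp ltnS.
  by case: (size p) le2 => [|[|[|s]]] //= _; lia.
have le2 (c : F) : (size (1 + c *: 'X)%R <= 2)%N.
  rewrite (leq_trans (size_polyD _ _)) // size_poly1 geq_max /=.
  by rewrite (leq_trans (size_scale_leq _ _)) // size_polyX.
have sa := size_exp_leq _ a (le2 1); have sb := size_exp_leq _ b (le2 (-1)).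
rewrite scale1r in sa; rewrite scaleN1r in sb.
rewrite (leq_trans (size_polyMleq _ _)) //.
by move: sa sb; move: (size _) (size _) => u v; lia.
Qed.

Lemma coef_kraw_size (F : fieldType) (a b i : nat) :
  (a + b < i)%N -> (kraw F a b)`_i = 0.
Proof. by move=> lt; rewrite nth_default // (leq_trans (size_kraw F a b)). Qed.

(** * Linear independence *)

(** At X = -1 only the term without a factor 1 + X survives; its coefficient is
therefore 0, and 1 + X can be cancelled from the others. *)
Lemma kraw_free (F : fieldType) (N : nat) (c : nat -> F) : 2 != 0 :> F ->
  \sum_(j < N.+1) c j *: kraw F j (N - j) = 0 -> forall j, (j <= N)%N -> c j = 0.
Proof.
move=> nz2; elim: N c => [|N IHN] c.
  rewrite big_ord1 /kraw mulr1 alg_polyC => /eqP; rewrite polyC_eq0 => /eqP c0.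
  by case.
rewrite big_ord_recl => sum0.
have stepE (j : nat) : kraw F j.+1 (N.+1 - j.+1) = (1 + 'X) * kraw F j (N - j).
  by rewrite /kraw subSS exprS mulrA.
have sumE : \sum_(j < N.+1) c (lift ord0 j) *: kraw F (lift ord0 j) (N.+1 - lift ord0 j)
    = (1 + 'X) * \sum_(j < N.+1) c j.+1 *: kraw F j (N - j).
  by rewrite mulr_sumr; apply: eq_bigr => j _; rewrite lift0 stepE scalerAr.
rewrite sumE {sumE} subn0 in sum0; have c0 : c 0 = 0.
  have /eqP := congr1 (horner^~ (-1)) sum0.
  rewrite /= [kraw F _ _]mul1r; move: (\sum_(_ < _) _) => q.
  rewrite !hornerE subrr mul0r addr0 opprK mulf_eq0 expf_eq0 (negPf nz2).
  by rewrite andbF orbF => /eqP.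
rewrite c0 scale0r add0r in sum0; case/eqP: sum0; rewrite mulf_eq0.
have nzX : 1 + 'X != 0 :> {poly F} by rewrite addrC -polyC1 -size_poly_eq0 size_XaddC.
rewrite (negPf nzX) /= => /eqP sum0 [//|j lt_jN].
exact: (IHN (fun j => c j.+1)).
Qed.

Lemma even_poly_eq0 (F : fieldType) (p : {poly F}) :
  even_poly p = 0 -> p \Po (- 'X) = - p.
Proof.
move=> ev0; rewrite -[p in LHS]poly_even_odd -[p in RHS]poly_even_odd ev0.
rewrite comp_poly0 !add0r comp_polyM comp_polyX -comp_polyA comp_Xn_poly.
by rewrite sqrrN mulrN.
Qed.

(** Exchanging u and v is the substitution of - X for X, which preserves even
parts. *)
Lemma even_kraw_middle (F : fieldType) (m : nat) :
  even_poly (kraw F m m.+1) = even_poly (kraw F m.+1 m).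
Proof.
apply/eqP; rewrite eq_sym -subr_eq0 -raddfB /=.
have -> : kraw F m.+1 m - kraw F m m.+1 = ((2 *: (1 - 'X) ^+ m) \Po 'X^2) * 'X.
  rewrite comp_polyZ rmorphXn /= comp_polyB comp_polyX -polyC1 comp_polyC polyC1 /kraw.
  have -> : 1 - 'X^2 = (1 + 'X) * (1 - 'X) :> {poly F} by ring.
  rewrite exprMn !exprS -mul_polyC polyC_natr; move: (_ ^+ _) (_ ^+ _) => *; ring.
apply/eqP/polyP => i; rewrite even_polyMX coefMX coef0.
by case: i => [|i] //=; rewrite coef_odd_poly coef_comp_poly_Xn // dvdn2 /= odd_double.
Qed.

(** Let p be a combination of the u^(m+1+j) v^(m-j) whose even part is 0. Then
p is odd and divisible by u^(m+1), hence also by v^(m+1), which is coprime to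
u^(m+1). As p has degree at most 2m+1, it is 0. *)
Lemma even_kraw_free (F : fieldType) (m : nat) (c : nat -> F) : 2 != 0 :> F ->
  \sum_(j < m.+1) c j *: even_poly (kraw F (m.+1 + j) (m - j)) = 0 ->
  forall j, (j <= m)%N -> c j = 0.
Proof.
move=> nz2 sum0; pose q := \sum_(j < m.+1) c j *: kraw F j (m - j).
pose p := (1 + 'X) ^+ m.+1 * q.
have evp : even_poly p = 0.
  rewrite -sum0 /p mulr_sumr linear_sum /=; apply: eq_bigr => j _.
  by rewrite -scalerAr linearZ /= /kraw mulrA -exprD.
have size_q : (size q <= m.+1)%N.
  apply: (leq_trans (size_sum _ _ _)); apply/bigmax_leqP => j _.
  rewrite (leq_trans (size_scale_leq _ _)) // (leq_trans (size_kraw _ _ _)) //.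
  by rewrite subnKC // -ltnS.
have size_lin : size (1 - 'X : {poly F}) = 2.
  by rewrite -size_polyN opprB -polyC1 size_XsubC.
have size_pow : size ((1 - 'X) ^+ m.+1 : {poly F}) = m.+2.
  rewrite -[LHS]prednK ?size_exp ?size_lin ?mul1n //.
  by rewrite size_poly_gt0 expf_neq0 // -size_poly_eq0 size_lin.
have coprime : coprimep ((1 - 'X) ^+ m.+1 : {poly F}) ((1 + 'X) ^+ m.+1).
  apply: coprimep_expl; apply: coprimep_expr.
  apply/Bezout_eq1_coprimepP; exists (2^-1%:P, 2^-1%:P) => /=.
  rewrite -mulrDr addrACA addNr addr0 -polyC1 -polyCD -polyCM; congr _%:P.
  exact: mulVf.
have dvd_q : (1 - 'X) ^+ m.+1 %| q.
  rewrite -(Gauss_dvdpr q coprime) -/p -dvdpNr -(even_poly_eq0 evp) /p.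
  rewrite comp_polyM rmorphXn /= comp_polyD comp_polyX -polyC1 comp_polyC.
  exact: dvdp_mulIl.
apply: (@kraw_free F m c nz2); apply/eqP; case: (altP (q =P 0)) => // nz_q.
have := leq_trans (dvdp_leq nz_q dvd_q) size_q.
by rewrite size_pow ltnn.
Qed.

Lemma det_neq0 (F : fieldType) (m : nat) (f : nat -> nat -> F) :
  (forall c : nat -> F,
     (forall i, (i <= m)%N -> \sum_(j < m.+1) c j * f i j = 0) ->
     forall j, (j <= m)%N -> c j = 0) ->
  \det (\matrix_(i < m.+1, j < m.+1) f i j) != 0.
Proof.
move=> free; rewrite -det_tr; apply/det0P => -[v nz_v /rowP vA0].
case/eqP: nz_v; apply/rowP => j; rewrite mxE -[j]inord_val.
apply: (free (fun j => v 0 (inord j))); last by rewrite -ltnS.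
move=> i le_im; rewrite -ltnS in le_im; have := vA0 (Ordinal le_im).
rewrite !mxE; apply: etrans; apply: eq_bigr => k _.
by rewrite !mxE inord_val.
Qed.

Lemma det_intertwine (F : fieldType) (n : nat) (M T W : 'M[F]_n) :
  \det T != 0 -> M *m T = T *m W -> \det M = \det W.
Proof.
move=> nzT /(congr1 determinant); rewrite !det_mulmx mulrC => eqT.
exact: (mulfI nzT).
Qed.

(** * Sylvester's determinant *)

(** The coefficients of the u^j v^(m-j) are a basis of eigenvectors of
Sylvester's matrix. *)
Lemma Sylv_prod (F : fieldType) (m : nat) (z : F) : 2 != 0 :> F ->
  Sylv z m = \prod_(j < m.+1) (z - m%:R + 2 * j%:R).
Proof.
move=> nz2; pose f i j := (kraw F j (m - j))`_i.
pose dg := \row_(j < m.+1) (z - m%:R + 2 * j%:R).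
rewrite /Sylv (@det_intertwine _ _ _ (\matrix_(i < m.+1, j < m.+1) f i j) (diag_mx dg)).
- by rewrite det_diag; apply: eq_bigr => j _; rewrite mxE.
- apply: det_neq0 => c c0; apply: (kraw_free nz2); apply/polyP => i.
  rewrite coef_sum coef0; case: (leqP i m) => [/c0 sum0|lt_mi].
    by rewrite -[RHS]sum0; apply: eq_bigr => j _; rewrite coefZ.
  rewrite big1 // => j _; rewrite coefZ coef_kraw_size ?mulr0 //.
  by rewrite subnKC // -ltnS.
apply/matrixP => i j; rewrite mxE.
under eq_bigr => k _ do rewrite [X in _ * X]mxE.
have le_jm : (j <= m)%N by rewrite -ltnS.
have nj : (m = j + (m - j))%N by rewrite subnKC.
rewrite (sum_tridiag_row _ _ (f := fun k => f k j)); last first.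
  by rewrite /f coef_kraw_size ?mulr0 // -nj.
rewrite mul_mx_diag !mxE /f.
have := congr1 (fun p : {poly F} => p`_i) (kraw_eigen F j (m - j)).
rewrite -nj -!polyC_natr -polyCB coefCM coefD coef_deriv coef_raise natrB // => eig.
transitivity (z * (kraw F j (m - j))`_i +
    (j%:R - (m%:R - j%:R)) * (kraw F j (m - j))`_i).
  by rewrite -eig; case: (nat_of_ord i) => [|i'] /=; ring.
by ring.
Qed.

(** * The determinant P *)

Lemma coef_pencil (F : fieldType) (N i : nat) (x : F) (p : {poly F}) :
  (pencil N x p)`_i =
    (N%:R - 2 * i%:R) * x * p`_i + i.+2%:R * i.+1%:R * p`_i.+2 -
    (if (i <= 1)%N then 0 else
       (N%:R - i%:R + 1) * (N%:R - i%:R + 2) * p`_i.-2).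
Proof.
rewrite /pencil coefD (coefB _^`() (raise _ _)) coefCM (coefB _^`() (raise _ _)).
rewrite !coef_deriv !coef_raise coef_deriv.
by case: i => [|[|i]] /=; rewrite ?coef_raise ?coef_deriv /=; ring.
Qed.

Lemma prod_progression_ends (R : comNzRingType) (k : nat) (c d : R) :
  \prod_(j < k.+2) (c + d * j%:R) =
    c * (c + d * k.+1%:R) * \prod_(j < k) (c + d + d * j%:R).
Proof.
rewrite big_ord_recl big_ord_recr /= mulr0 addr0 -mulrA; congr (_ * _).
by rewrite mulrC; congr (_ * _); apply: eq_bigr => j _; rewrite -natr1; ring.
Qed.

(** Past the corner the diagonal is 0, so the recurrence goes from k to k.+2
and multiplies, up to sign, by the four linear factors in x and y that are
added at the two ends of the progressions. *)
Lemma det_corner_tridiag (F : fieldType) (k : nat) (x y : F) :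
  \det (tridiag k (fun i => if i == 1 then x * y else 0)
                  (fun i => (2 * i%:R + x) * (y + i%:R))
                  (fun i => - ((2 * i%:R - x) * (y - i%:R)))) =
  (-1) ^+ k./2 * \prod_(j < k) (x - 2 * (k%:R - 1) + 4 * j%:R) *
    \prod_(j < k) (y - (k%:R - 1) + 2 * j%:R).
Proof.
have [n le_kn] := ubnP k; elim: n => // n IHn in k le_kn *.
case: k le_kn => [|[|k]] le_kn.
- by rewrite det_tridiag0 !big_ord0 !mulr1.
- rewrite det_tridiag1 !big_ord1 /= expr0; ring.
rewrite det_tridiagSS /= mul0r add0r IHn; last by lia.
rewrite !prod_progression_ends.
have -> : x - 2 * (k.+2%:R - 1) + 4 = x - 2 * (k%:R - 1) by ring.
have -> : y - (k.+2%:R - 1) + 2 = y - (k%:R - 1) by ring.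
by rewrite exprS; move: (_ ^+ _) (\prod_(_ < _) _) (\prod_(_ < _) _) => *; ring.
Qed.

(** Up to order, the factors on the left are those on the right with alternating
signs, the largest being positive. *)
Lemma prod_signed_progression (F : fieldType) (k : nat) :
  \prod_(j < k) (1 - 2 * (k%:R - 1) + 4 * j%:R) =
    (-1) ^+ k./2 * \prod_(j < k) (1 + 2 * j%:R) :> F.
Proof.
have [n le_kn] := ubnP k; elim: n => // n IHn in k le_kn *.
case: k le_kn => [|[|k]] le_kn.
- by rewrite !big_ord0 mulr1.
- by rewrite !big_ord1 /= expr0; ring.
rewrite prod_progression_ends [in RHS]big_ord_recr [in RHS]big_ord_recr /=.
have -> : 1 - 2 * (k.+2%:R - 1) + 4 = 1 - 2 * (k%:R - 1) :> F by ring.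
rewrite IHn; last by lia.
by rewrite exprS; move: (_ ^+ _) (\prod_(_ < _) _) => *; ring.
Qed.

(** Both sides are determinants of the pencil on even polynomials: on the left
in the basis of the powers of X, on the right in the basis of the even parts of
the u^(m+1+j) v^(m-j). *)
Lemma P_corner_tridiag (F : fieldType) (m : nat) (x : F) : 2 != 0 :> F ->
  P m.+1 x (m.*2.+1)%:R =
    \det (tridiag m.+1 (fun i => if i == 1 then x * m.+1%:R else 0)
                  (fun i => (2 * i%:R + x) * (m.+1%:R + i%:R))
                  (fun i => - ((2 * i%:R - x) * (m.+1%:R - i%:R)))).
Proof.
move=> nz2; set N := m.*2.+1.
pose g j := kraw F (m.+1 + j) (m - j); pose f i j := (g j)`_i.*2.
have degN j : (j <= m)%N -> N = (m.+1 + j + (m - j))%N by rewrite /N; lia.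
apply: (@det_intertwine _ _ _ (\matrix_(i < m.+1, j < m.+1) f i j)).
  apply: det_neq0 => c c0; apply: (even_kraw_free nz2); apply/polyP => i.
  rewrite coef_sum coef0; case: (leqP i m) => [/c0 sum0|lt_mi].
    by rewrite -[RHS]sum0; apply: eq_bigr => j _; rewrite coefZ coef_even_poly.
  rewrite big1 // => j _; rewrite coefZ coef_even_poly coef_kraw_size ?mulr0 //.
  by rewrite -degN ?/N; [lia | rewrite -ltnS].
apply/matrixP => i j; rewrite !mxE.
under eq_bigr => k _ do rewrite [X in _ * X]mxE.
under [RHS]eq_bigr => k _ do rewrite [X in X * _]mxE.
have le_jm : (j <= m)%N by rewrite -ltnS.
rewrite (sum_tridiag_row _ _ (f := fun k => f k j)); last first.
  by rewrite /f /g coef_kraw_size ?mulr0 // -degN // /N; lia.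
rewrite (sum_tridiag_col _ _ (f := fun k => f i k)); last first.
  by rewrite subrr mulr0 oppr0 mul0r.
have eig := congr1 (fun p : {poly F} => p`_i.*2) (pencil_kraw (m.+1 + j) (m - j) x nz2).
rewrite -/(g j) -degN // coef_pencil in eig.
(* The left side is the coefficient of the pencil at 2i. *)
transitivity ((N%:R - 2 * (i.*2)%:R) * x * (g j)`_i.*2 +
  (i.*2.+2)%:R * (i.*2.+1)%:R * (g j)`_(i.*2).+2 -
  (if (i.*2 <= 1)%N then 0
   else (N%:R - (i.*2)%:R + 1) * (N%:R - (i.*2)%:R + 2) * (g j)`_(i.*2).-2)).
  rewrite /f /a.
  have half2 (z : F) : 2 * (z / 2) = z by rewrite mulrC divfK.
  rewrite half2 doubleS -!muln2 !natrM; case: (nat_of_ord i) => [|i'] /=.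
    by ring.
  rewrite ?mulSn /=; ring.
rewrite eig coefB !coefZ /f /g !addnS addSn subnS natrB //=.
case: (nat_of_ord j) le_jm => [|j'] /= le_jm.
  (* The neighbour u^m v^(m+1) lies outside the family; its even part is that
     of u^(m+1) v^m, whence the corner entry. *)
  have := congr1 (fun p : {poly F} => p`_i) (even_kraw_middle F m).
  rewrite /= !coef_even_poly addn0 subn0 => ->; ring.
by rewrite subnSK // addSnnS; ring.
Qed.

Unset Implicit Arguments.

Theorem corollary7p27 (F : fieldType) (charF0 : [pchar F] =i pred0)
    (n : nat) (n_odd : odd n) (x : F) :
  P (n + 1)./2 x n%:R =
    2 ^+ (n + 1) * Sylv (1 / 2) (n - 1)./2 * Sylv (x / 2) (n - 1)./2.
Proof.
have nz2 : 2 != 0 :> F by move/pcharf0P: charF0 => ->.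
have [m ->] : exists m, n = m.*2.+1 by exists n./2; rewrite -[LHS]odd_double_half n_odd.
rewrite addn1 subn1 /= doubleK -doubleS -(addnn m.+1) exprD.
have scale (z : F) : 2 ^+ m.+1 * Sylv (z / 2) m =
    \prod_(j < m.+1) (z - 2 * (m.+1%:R - 1) + 4 * j%:R).
  have -> : 2 ^+ m.+1 = \prod_(j < m.+1) 2 :> F by rewrite prodr_const card_ord.
  rewrite Sylv_prod // -big_split /=.
  by apply: eq_bigr => j _; field.
have const : \prod_(j < m.+1) (m.+1%:R - (m.+1%:R - 1) + 2 * j%:R) =
    \prod_(j < m.+1) (1 + 2 * j%:R) :> F.
  by apply: eq_bigr => j _; ring.
rewrite P_corner_tridiag // det_corner_tridiag const mulrAC.
rewrite -prod_signed_progression -!scale.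
by move: (_ ^+ _) => c; ring.
Qed.
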